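(* Let $T = \langle S, Act, \to\rangle$ be a labelled transition system. Then for all states $s, s' \in S$: $s$ and $s'$ are bisimilar in $T$ if and only if $s$ and $s'$ are bisimilar in the Kripke structure $\mathsf{ks}(T)$.
   Context: A Kripke structure is $K=\langle S, AP, \to, L\rangle$ with $S$ a set of states, $AP$ a set of atomic propositions, $\to\,\subseteq S\times S$ a total transition relation (for every $s\in S$ there is $t\in S$ with $s\to t$), and $L: S\to 2^{AP}$ a state labelling. A labelled transition system (LTS) is $T=\langle S, Act, \to\rangle$ with $S$ a set of states, $Act$ a set of actions, a special silent action $\tau\notin Act$, and a transition relation $\to\,\subseteq S\times(Act\cup\{\tau\})\times S$ that is total (for every $s\in S$ there are $a\in Act$, $t\in S$ with $s\xrightarrow{a}t$). The embedding $\mathsf{ks}$: for an LTS $T=\langle S,Act,\to\rangle$, $\mathsf{ks}(T)=\langle S', AP, \to', L\rangle$ where $S' = S\cup\{(s,a,t)\in\,\to \mid a\neq\tau\}$, $AP = Act\cup\{\bot\}$ with $\bot\notin Act$ fresh, $\to'$ is the least relation such that for every transition $(s,a,t)$ with $a\neq\tau$ we have $s\to'(s,a,t)$ and $(s,a,t)\to' t$, and $s\to' t$ whenever $s\xrightarrow{\tau}t$; and $L(s)=\{\bot\}$ for $s\in S$, $L((s,a,t))=\{a\}$. Simulation in a Kripke structure: a relation $B\subseteq S\times S$ is a simulation iff for all $(s,s')\in B$: $L(s)=L(s')$, and for every $t$ with $s\to t$ there is $t'$ with $s'\to t'$ and $(t,t')\in B$. Simulation in an LTS: $B\subseteq S\times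 S$ is a simulation iff for all $(s,s')\in B$, all $a\in Act\cup\{\tau\}$ and all $t$ with $s\xrightarrow{a}t$ there is $t'$ with $s'\xrightarrow{a}t'$ and $(t,t')\in B$. In either setting, states $s,s'$ are bisimilar iff there is a symmetric simulation relation $B$ with $(s,s')\in B$. *)

(* Defs.v *)
From Stdlib Require Import Relations Ensembles.

Set Implicit Arguments.

Record kripke := Kripke {
  kstate : Type;
  AP : Type;
  kstep : kstate -> kstate -> Prop;
  kstep_total : forall s, exists t, kstep s t;
  klabel : kstate -> Ensemble AP
}.

(* [Act ∪ {τ}] is [option act], with [None] for τ.  Totality asks for a
   visible action: a τ-step alone does not suffice. *)
Record lts := Lts {
  lstate : Type;
  act : Type;
  lstep : lstate -> option act -> lstate -> Prop;
  lstep_total : forall s, exists (a : act) (t : lstate), lstep s (Some a) t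
}.

(* Label sets are compared extensionally. *)
Definition kripke_simulation (K : kripke) (B : relation (kstate K)) : Prop :=
  forall s s', B s s' ->
    Same_set (AP K) (klabel K s) (klabel K s') /\
    forall t, kstep K s t -> exists t', kstep K s' t' /\ B t t'.

Definition lts_simulation (T : lts) (B : relation (lstate T)) : Prop :=
  forall s s', B s s' ->
    forall (a : option (act T)) t, lstep T s a t ->
      exists t', lstep T s' a t' /\ B t t'.

Definition kripke_bisimilar (K : kripke) (s s' : kstate K) : Prop :=
  exists B : relation (kstate K),
    symmetric (kstate K) B /\ kripke_simulation K B /\ B s s'.

Definition lts_bisimilar (T : lts) (s s' : lstate T) : Prop :=
  exists B : relation (lstate T),
    symmetric (lstate T) B /\ lts_simulation T B /\ B s s'.

(* The disjoint union of S and the visible transitions (s, a, t); up to proof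
   irrelevance, [ks_trans] is determined by the triple alone. *)
Inductive ks_state (T : lts) : Type :=
| ks_base (s : lstate T)
| ks_trans (s : lstate T) (a : act T) (t : lstate T) (h : lstep T s (Some a) t).

Arguments ks_base {T} s.
Arguments ks_trans {T} s a t h.

Inductive ks_step (T : lts) : ks_state T -> ks_state T -> Prop :=
| ks_step_enter s a t (h : lstep T s (Some a) t) :
    ks_step (ks_base s) (ks_trans s a t h)
| ks_step_leave s a t (h : lstep T s (Some a) t) :
    ks_step (ks_trans s a t h) (ks_base t)
| ks_step_tau s t : lstep T s None t -> ks_step (ks_base s) (ks_base t).

Lemma ks_step_total (T : lts) (x : ks_state T) : exists y, ks_step x y.
Proof.
destruct x as [s | s a t h].
- destruct (lstep_total T s) as [a [t h]].
  exists (ks_trans s a t h); constructor.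
- exists (ks_base t); constructor.
Qed.

(* Here [None] is the fresh proposition ⊥ of [AP = Act ∪ {⊥}], not τ. *)
Definition ks_label (T : lts) (x : ks_state T) : Ensemble (option (act T)) :=
  match x with
  | ks_base _ => Singleton _ None
  | ks_trans _ a _ _ => Singleton _ (Some a)
  end.

Definition ks (T : lts) : kripke :=
  {| kstate := ks_state T;
     AP := option (act T);
     kstep := @ks_step T;
     kstep_total := @ks_step_total T;
     klabel := @ks_label T |}.

(* Main.v *)
(** An LTS bisimulation lifts to [ks T] by relating two transition states when
    they carry the same action and have related targets.  Conversely, a
    bisimulation of [ks T] restricts to [S]: since the labels tell base states
    apart from transition states and record the action, a visible step is
    matched by two steps through a state with the same action, and a τ-step is
    matched by a τ-step. *)
From Stdlib Require Import Relations Ensembles.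
Require Import Defs.

Lemma Same_set_Singleton (U : Type) (x y : U) :
  Same_set U (Singleton U x) (Singleton U y) <-> x = y.
Proof.
split.
- intros [Hxy _].
  specialize (Hxy x (In_singleton U x)).
  now inversion Hxy.
- intros <-; split; intros z Hz; exact Hz.
Qed.

(** The sources of two related transition states are left unconstrained: what follows a transition
    state depends only on its label and its single successor, the target. *)
Inductive ks_lift (T : lts) (B : relation (lstate T)) : relation (ks_state T) :=
| ks_lift_base s s' : B s s' -> ks_lift T B (ks_base s) (ks_base s')
| ks_lift_trans s s' a t t' (h : lstep T s (Some a) t)
    (h' : lstep T s' (Some a) t') :
    B t t' -> ks_lift T B (ks_trans s a t h) (ks_trans s' a t' h').

Lemma ks_lift_symmetric (T : lts) (B : relation (lstate T)) :
  symmetric _ B -> symmetric _ (ks_lift T B).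
Proof. intros HB x y [s s' H | s s' a t t' h h' H]; constructor; auto. Qed.

Lemma ks_lift_simulation (T : lts) (B : relation (lstate T)) :
  lts_simulation T B -> kripke_simulation (ks T) (ks_lift T B).
Proof.
intros HB x y [s s' H | s s' a t t' h h' H]; simpl;
  (split; [now apply Same_set_Singleton |]); intros z Hz; inversion Hz; subst.
(* The cases are, in order: entering a transition state, a τ-step, leaving for the target. *)
- destruct (HB _ _ H _ _ h) as [t' [h' Ht]].
  exists (ks_trans s' a t' h'); split; now constructor.
- match goal with Hs : lstep T s None _ |- _ =>
    destruct (HB _ _ H _ _ Hs) as [t' [h' Ht]] end.
  exists (ks_base t'); split; now constructor.
- exists (ks_base t'); split; now constructor.
Qed.

Lemma ks_restrict_simulation (T : lts) (B : relation (ks_state T)) :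
  kripke_simulation (ks T) B ->
  lts_simulation T (fun s s' => B (ks_base s) (ks_base s')).
Proof.
intros HB s s' H [a |] t h; destruct (HB _ _ H) as [_ Hstep].
- destruct (Hstep _ (ks_step_enter T s a t h)) as [y [Hy Hty]].
  destruct (HB _ _ Hty) as [Hlab Hstep'].
  destruct y as [u | s0 b t' h']; apply Same_set_Singleton in Hlab;
    [discriminate |].
  injection Hlab as <-.
  destruct (Hstep' _ (ks_step_leave T s a t h)) as [z [Hz Htz]].
  (* [Hy] forces [s0] to be [s'], so the proof [h'] stored in the matching state is the visible step
     sought; [Hz] makes [z] the base state of [t']. *)
  inversion Hy; subst; inversion Hz; subst.
  exists t'; now split.
- destruct (Hstep _ (ks_step_tau T s t h)) as [y [Hy Hty]].
  destruct (HB _ _ Hty) as [Hlab _].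
  destruct y as [t' | s0 b t' h']; apply Same_set_Singleton in Hlab;
    [| discriminate].
  (* Only a τ-step joins two base states. *)
  inversion Hy; subst.
  exists t'; now split.
Qed.

Theorem theorem3p10 (T : lts) (s s' : lstate T) :
  lts_bisimilar T s s' <-> kripke_bisimilar (ks T) (ks_base s) (ks_base s').
Proof.
split; intros [B [Hsym [Hsim H]]].
- exists (ks_lift T B); split; [| split].
  + now apply ks_lift_symmetric.
  + now apply ks_lift_simulation.
  + now constructor.
- exists (fun u u' => B (ks_base u) (ks_base u')); split; [| split].
  + intros u u'; apply Hsym.
  + now apply ks_restrict_simulation.
  + exact H.
Qed.
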